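(* Let $\mathcal{C}$ be a $J$-category in which all objects are cofibrant models. If $p:E\to B$ is any morphism in $\mathcal{C}$, then $$\mathrm{Gsecat}(p)=\mathrm{Wsecat}(p).$$
   Context: **$J$-category.** A $J$-category $\mathcal{C}$ is a category with a zero object $0$ and three classes of morphisms, called fibrations, cofibrations and weak equivalences, satisfying (J1)-(J5) below. A trivial fibration (resp. trivial cofibration) is a fibration (resp. cofibration) that is also a weak equivalence. An object $B$ is a cofibrant model if every trivial fibration $E\to B$ admits a section. (J1) Isomorphisms are trivial cofibrations and trivial fibrations. Fibrations and cofibrations are closed under composition. If two of $f,g,gf$ are weak equivalences, so is the third. (J2) The pullback of a fibration $p:E\to B$ along any morphism $f:B'\to B$ exists, with projections $\overline p:E'\to B'$ and $\overline f:E'\to E$, and $\overline p$ is a fibration; if $f$ (resp. $p$) is a weak equivalence, so is $\overline f$ (resp. $\overline p$). The dual statement (pushouts of cofibrations) also holds. (J3) Every morphism $f$ has an $F$-factorization $f=p\tau$ ($\tau$ a weak equivalence, $p$ a fibration) and a $C$-factorization $f=\sigma i$ ($i$ a cofibration, $\sigma$ a weak equivalence). (J4) For every object $X$ there is a trivial fibration $\overline X\to X$ with $\overline X$ a cofibrant model. (J5) (Cube axiom) In any commutative cube whose bottom face is a homotopy pushout and whose vertical faces are homotopy pullbacks, the top face is a homotopy pushout. Here a commutative square with maps $D\to C$, $D\to A$, $g:C\to B$, $f:A\to B$ is a homotopy pullback if for some (equivalently any) $F$-factorization $C\to E\to B$ of $g$ the induced morphism $D\to A\times_B E$ is a weak equivalence.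 Homotopy pushouts are defined dually. **Join.** Given $f:A\to B$ and $g:C\to B$, choose an $F$-factorization $g=p\tau$, $p:E\to B$; form the pullback $E'=A\times_B E$ with projections $\overline p:E'\to A$, $\overline f:E'\to E$; choose a $C$-factorization $\overline f=\sigma i$, $i:E'\to Z$, $\sigma: Z\to E$; let $A*_BC$ be the pushout of $\overline p$ and $i$. The join morphism of $f$ and $g$ is the morphism $A*_BC\to B$ induced by $f:A\to B$ and $p\sigma:Z\to B$. It is well defined up to weak equivalence. **Weak lifting and weak section** (all objects being cofibrant models). $f:A\to B$ admits a weak lifting along $g:C\to B$ if for some (equivalently any) $F$-factorization $g=p\tau$, with $p:E\to B$, there is $s:A\to E$ with $ps=f$. A morphism $g:C\to B$ admits a weak section if $\mathrm{id}_B$ admits a weak lifting along $g$. **Ganea sectional category.** For $p:E\to B$ define inductively $h_n:*^n_BE\to B$: $h_0=p$ (so $*^0_BE=E$), and $h_n$ is the join morphism of $h_{n-1}:*^{n-1}_BE\to B$ and $p:E\to B$ (with $*^n_BE=( *^{n-1}_BE)*_BE$). $\mathrm{Gsecat}(p)$ is the least integer $n\ge 0$ such that $h_n$ admits a weak section, and $\infty$ if there is no such $n$. **Whitehead sectional category.** An object $B$ is $e$-fibrant if $B\to 0$ is a fibration. For $p:E\to B$ with $B$ $e$-fibrant define inductively $j_n:T^n(p)\to B^{n+1}$: $j_0=p$ (so $T^0(p)=E$), and $j_n$ is the join morphism of $j_{n-1}\times\mathrm{id}_B:T^{n-1}(p)\times B\to B^{n+1}$ and $\mathrm{id}_{B^n}\times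 p:B^n\times E\to B^{n+1}$, with $T^n(p)$ the corresponding join object. $\mathrm{Wsecat}(p)$ is the least integer $n\ge0$ such that the diagonal $\Delta_{n+1}:B\to B^{n+1}$ admits a weak lifting along $j_n$, and $\infty$ if there is none. For general $B$, one chooses an $F$-factorization $B\xrightarrow{\tau}F\to 0$ of the zero morphism and sets $\mathrm{Wsecat}(p):=\mathrm{Wsecat}(\tau p)$; this does not depend on the choice of the $F$-factorization. *)

(* Defs.v *)
From mathcomp Require Import all_boot boolp.

Set Implicit Arguments.
Unset Strict Implicit.
Unset Printing Implicit Defensive.

Record category := Category {
  obj :> Type;
  hom : obj -> obj -> Type;
  idm : forall X, hom X X;
  comp : forall X Y Z, hom Y Z -> hom X Y -> hom X Z;
  compA : forall W X Y Z (h : hom Y Z) (g : hom X Y) (f : hom W X),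
    comp h (comp g f) = comp (comp h g) f;
  comp1m : forall X Y (f : hom X Y), comp (idm Y) f = f;
  compm1 : forall X Y (f : hom X Y), comp f (idm X) = f }.

Arguments idm {_} _.
Notation "g ∘ f" := (comp g f) (at level 40, left associativity).

Section CategoryNotions.
Variable C : category.

Definition isom (X Y : C) (f : hom X Y) : Prop :=
  exists g : hom Y X, g ∘ f = idm X /\ f ∘ g = idm Y.

Definition is_pullback (A E B P : C) (f : hom A B) (g : hom E B)
    (p1 : hom P A) (p2 : hom P E) : Prop :=
  f ∘ p1 = g ∘ p2 /\
  forall (X : C) (x : hom X A) (y : hom X E), f ∘ x = g ∘ y ->
    exists! u : hom X P, p1 ∘ u = x /\ p2 ∘ u = y.

Definition is_pushout (B A E P : C) (f : hom B A) (g : hom B E)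
    (i1 : hom A P) (i2 : hom E P) : Prop :=
  i1 ∘ f = i2 ∘ g /\
  forall (X : C) (x : hom A X) (y : hom E X), x ∘ f = y ∘ g ->
    exists! u : hom P X, u ∘ i1 = x /\ u ∘ i2 = y.

Record pullback (A E B : C) (f : hom A B) (g : hom E B) := Pullback {
  pb_obj : C;
  pb_fst : hom pb_obj A;
  pb_snd : hom pb_obj E;
  pb_is_pullback : is_pullback f g pb_fst pb_snd }.

Record pushout (B A E : C) (f : hom B A) (g : hom B E) := Pushout {
  po_obj : C;
  po_inl : hom A po_obj;
  po_inr : hom E po_obj;
  po_is_pushout : is_pushout f g po_inl po_inr }.

Record product (X Y : C) := Product {
  pr_obj : C;
  pr_fst : hom pr_obj X;
  pr_snd : hom pr_obj Y;
  pr_pair : forall Z : C, hom Z X -> hom Z Y -> hom Z pr_obj;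
  pr_fst_pair : forall (Z : C) (f : hom Z X) (g : hom Z Y),
    pr_fst ∘ pr_pair f g = f;
  pr_snd_pair : forall (Z : C) (f : hom Z X) (g : hom Z Y),
    pr_snd ∘ pr_pair f g = g;
  pr_pair_uniq : forall (Z : C) (u v : hom Z pr_obj),
    pr_fst ∘ u = pr_fst ∘ v -> pr_snd ∘ u = pr_snd ∘ v -> u = v }.

Definition prod_map (X Y X' Y' : C) (Q : product X Y) (Q' : product X' Y')
    (f : hom X X') (g : hom Y Y') : hom (pr_obj Q) (pr_obj Q') :=
  pr_pair Q' (f ∘ pr_fst Q) (g ∘ pr_snd Q).

End CategoryNotions.

Record jdata := JData {
  jcat :> category;
  zero : jcat;
  to_zero : forall X : jcat, hom X zero;
  from_zero : forall X : jcat, hom zero X;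
  to_zero_uniq : forall (X : jcat) (f : hom X zero), f = to_zero X;
  from_zero_uniq : forall (X : jcat) (f : hom zero X), f = from_zero X;
  fibration : forall X Y : jcat, hom X Y -> Prop;
  cofibration : forall X Y : jcat, hom X Y -> Prop;
  weak_equiv : forall X Y : jcat, hom X Y -> Prop }.

Arguments zero {_}.
Arguments to_zero {_} _.
Arguments from_zero {_} _.

Section HomotopyNotions.
Variable C : jdata.

Definition trivial_fibration (X Y : C) (f : hom X Y) : Prop :=
  fibration f /\ weak_equiv f.

Definition trivial_cofibration (X Y : C) (f : hom X Y) : Prop :=
  cofibration f /\ weak_equiv f.

Definition cofibrant_model (B : C) : Prop :=
  forall (E : C) (p : hom E B), trivial_fibration p ->
    exists s : hom B E, p ∘ s = idm B.

Record F_factorization (X Y : C) (f : hom X Y) := FFactorization {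
  F_obj : C;
  F_we : hom X F_obj;
  F_fib : hom F_obj Y;
  F_weP : weak_equiv F_we;
  F_fibP : fibration F_fib;
  F_eq : f = F_fib ∘ F_we }.

Record C_factorization (X Y : C) (f : hom X Y) := CFactorization {
  C_obj : C;
  C_cof : hom X C_obj;
  C_we : hom C_obj Y;
  C_cofP : cofibration C_cof;
  C_weP : weak_equiv C_we;
  C_eq : f = C_we ∘ C_cof }.

Definition homotopy_pullback (D A E B : C)
    (a : hom D A) (c : hom D E) (f : hom A B) (g : hom E B) : Prop :=
  f ∘ a = g ∘ c /\
  exists (F : F_factorization g) (P : pullback f (F_fib F))
         (u : hom D (pb_obj P)),
    [/\ pb_fst P ∘ u = a, pb_snd P ∘ u = F_we F ∘ c & weak_equiv u].

Definition homotopy_pushout (B A E D : C)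
    (f : hom B A) (g : hom B E) (a : hom A D) (c : hom E D) : Prop :=
  a ∘ f = c ∘ g /\
  exists (F : C_factorization g) (P : pushout f (C_cof F))
         (u : hom (po_obj P) D),
    [/\ u ∘ po_inl P = a, u ∘ po_inr P = c ∘ C_we F & weak_equiv u].

End HomotopyNotions.

(* The J2 fields split "the pullback exists and its projection is a fibration" into
   existence and a property of every pullback square; the two readings agree
   because pullbacks are unique up to isomorphism and by J1. *)
Record jaxioms (C : jdata) : Prop := JAxioms {
  J1_iso_cof : forall (X Y : C) (f : hom X Y), isom f -> trivial_cofibration f;
  J1_iso_fib : forall (X Y : C) (f : hom X Y), isom f -> trivial_fibration f;
  J1_fib_comp : forall (X Y Z : C) (g : hom Y Z) (f : hom X Y),
    fibration g -> fibration f -> fibration (g ∘ f);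
  J1_cof_comp : forall (X Y Z : C) (g : hom Y Z) (f : hom X Y),
    cofibration g -> cofibration f -> cofibration (g ∘ f);
  J1_we_comp : forall (X Y Z : C) (g : hom Y Z) (f : hom X Y),
    weak_equiv f -> weak_equiv g -> weak_equiv (g ∘ f);
  J1_we_left : forall (X Y Z : C) (g : hom Y Z) (f : hom X Y),
    weak_equiv f -> weak_equiv (g ∘ f) -> weak_equiv g;
  J1_we_right : forall (X Y Z : C) (g : hom Y Z) (f : hom X Y),
    weak_equiv g -> weak_equiv (g ∘ f) -> weak_equiv f;
  J2_pb_exists : forall (E B B' : C) (f : hom B' B) (p : hom E B),
    fibration p -> inhabited (pullback f p);
  J2_pb_fib : forall (E B B' E' : C) (f : hom B' B) (p : hom E B)
      (p' : hom E' B') (f' : hom E' E),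
    fibration p -> is_pullback f p p' f' -> fibration p';
  J2_pb_we_base : forall (E B B' E' : C) (f : hom B' B) (p : hom E B)
      (p' : hom E' B') (f' : hom E' E),
    fibration p -> is_pullback f p p' f' -> weak_equiv f -> weak_equiv f';
  J2_pb_we_fib : forall (E B B' E' : C) (f : hom B' B) (p : hom E B)
      (p' : hom E' B') (f' : hom E' E),
    fibration p -> is_pullback f p p' f' -> weak_equiv p -> weak_equiv p';
  J2_po_exists : forall (E B B' : C) (f : hom B B') (i : hom B E),
    cofibration i -> inhabited (pushout f i);
  J2_po_cof : forall (E B B' E' : C) (f : hom B B') (i : hom B E)
      (i' : hom B' E') (f' : hom E E'),
    cofibration i -> is_pushout f i i' f' -> cofibration i';
  J2_po_we_base : forall (E B B' E' : C) (f : hom B B') (i : hom B E)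
      (i' : hom B' E') (f' : hom E E'),
    cofibration i -> is_pushout f i i' f' -> weak_equiv f -> weak_equiv f';
  J2_po_we_cof : forall (E B B' E' : C) (f : hom B B') (i : hom B E)
      (i' : hom B' E') (f' : hom E E'),
    cofibration i -> is_pushout f i i' f' -> weak_equiv i -> weak_equiv i';
  J3_F : forall (X Y : C) (f : hom X Y), inhabited (F_factorization f);
  J3_C : forall (X Y : C) (f : hom X Y), inhabited (C_factorization f);
  J4 : forall X : C, exists (X' : C) (q : hom X' X),
    trivial_fibration q /\ cofibrant_model X';
  (* Unprimed objects form the bottom face, primed ones the top face, and
     r, s, t, v are the vertical edges. *)
  J5 : forall (K L M N K' L' M' N' : C)
      (kl : hom K L) (km : hom K M) (ln : hom L N) (mn : hom M N)
      (kl' : hom K' L') (km' : hom K' M') (ln' : hom L' N') (mn' : hom M' N')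
      (r : hom K' K) (s : hom L' L) (t : hom M' M) (v : hom N' N),
    ln' ∘ kl' = mn' ∘ km' ->
    homotopy_pushout kl km ln mn ->
    homotopy_pullback r kl' kl s ->
    homotopy_pullback r km' km t ->
    homotopy_pullback s ln' ln v ->
    homotopy_pullback t mn' mn v ->
    homotopy_pushout kl' km' ln' mn' }.

Record jcategory := JCategory {
  jbase :> jdata;
  jaxiomsP : jaxioms jbase }.

Section Join.
Variable C : jdata.

(* All the data chosen in a construction of the join of f and g; the join
   object is [join_obj] and the join morphism [join_mor]. *)
Record join (A G B : C) (f : hom A B) (g : hom G B) := Join {
  join_F : F_factorization g;
  join_pb : pullback f (F_fib join_F);
  join_C : C_factorization (pb_snd join_pb);
  join_po : pushout (pb_fst join_pb) (C_cof join_C);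
  join_mor : hom (po_obj join_po) B;
  join_mor_inl : join_mor ∘ po_inl join_po = f;
  join_mor_inr : join_mor ∘ po_inr join_po = F_fib join_F ∘ C_we join_C }.

Definition join_obj (A G B : C) (f : hom A B) (g : hom G B) (J : join f g) : C :=
  po_obj (join_po J).

Definition weak_lifting (A G B : C) (f : hom A B) (g : hom G B) : Prop :=
  exists (F : F_factorization g) (s : hom A (F_obj F)), F_fib F ∘ s = f.

Definition weak_section (G B : C) (g : hom G B) : Prop :=
  weak_lifting (idm B) g.

Definition e_fibrant (B : C) : Prop := fibration (to_zero B).

End Join.

Lemma e_fibrant_product (C : jcategory) (X Y : C) (Q : product X Y) :
  e_fibrant X -> e_fibrant Y -> e_fibrant (pr_obj Q).
Proof.
move=> hX hY; have ax := jaxiomsP C.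
rewrite /e_fibrant -(to_zero_uniq (to_zero Y ∘ pr_snd Q)).
apply: (J1_fib_comp ax) => //.
apply: (@J2_pb_fib _ ax _ _ _ _ (to_zero Y) (to_zero X) _ (pr_fst Q)) => //.
split; first by rewrite [LHS]to_zero_uniq [RHS]to_zero_uniq.
move=> Z y x _; exists (pr_pair Q x y); split.
  by rewrite pr_fst_pair pr_snd_pair.
move=> u [hy hx]; apply: (@pr_pair_uniq _ _ _ Q).
  by rewrite pr_fst_pair hx.
by rewrite pr_snd_pair hy.
Qed.

Lemma e_fibrant_replacement (C : jcategory) (B : C)
  (F : F_factorization (to_zero B)) : e_fibrant (F_obj F).
Proof. by rewrite /e_fibrant -(to_zero_uniq (F_fib F)); exact: F_fibP. Qed.

(* Joins, products and fibrant replacements are only determined up to (weak)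
   equivalence, so the two invariants are defined relative to a choice of all
   of them.  The products X x Y needed below have an e-fibrant factor, hence
   exist as pullbacks over the zero object. *)
Record choices (C : jcategory) := Choices {
  ch_join : forall (A G B : C) (f : hom A B) (g : hom G B), join f g;
  ch_prod : forall X Y : C, e_fibrant X \/ e_fibrant Y -> product X Y;
  ch_fib : forall B : C, F_factorization (to_zero B) }.

Lemma choices_exist (C : jcategory) : inhabited (choices C).
Proof.
have ax := jaxiomsP C.
have get T : inhabited T -> T.
  by move=> hT; apply: (proj1_sig (cid (P := fun _ : T => True) _)); case: hT => t; exists t.
have mkprod X Y (P : pullback (to_zero X) (to_zero Y)) : product X Y.
  case: P => P p1 p2 [_ univ].
  have ex Z (f : hom Z X) (g : hom Z Y) :
      {u : hom Z P | p1 ∘ u = f /\ p2 ∘ u = g}.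
    apply: cid; case: (univ Z f g) => [|u [hu _]]; last by exists u.
    by rewrite [LHS]to_zero_uniq [RHS]to_zero_uniq.
  exists P p1 p2 (fun Z f g => sval (ex Z f g)).
  - by move=> Z f g; case: (svalP (ex Z f g)).
  - by move=> Z f g; case: (svalP (ex Z f g)).
  - move=> Z u v h1 h2; case: (univ Z (p1 ∘ u) (p2 ∘ u)) => [|w [_ hw]].
      by rewrite [LHS]to_zero_uniq [RHS]to_zero_uniq.
    by rewrite -(hw u) // -(hw v).
have swap X Y (Q : product X Y) : product Y X.
  exists (pr_obj Q) (pr_snd Q) (pr_fst Q) (fun Z f g => pr_pair Q g f).
  - by move=> Z f g; exact: pr_snd_pair.
  - by move=> Z f g; exact: pr_fst_pair.
  - by move=> Z u v h1 h2; exact: pr_pair_uniq.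
constructor; constructor.
- move=> A G B f g; apply: get.
  have [F] := J3_F ax g.
  have [P] := J2_pb_exists ax f (F_fibP F).
  have [K] := J3_C ax (pb_snd P).
  have [Q] := J2_po_exists ax (pb_fst P) (C_cofP K).
  case: (po_is_pushout Q) => _ /(_ B f (F_fib F ∘ C_we K)) [|u [[u1 u2] _]].
    by rewrite -compA -C_eq; case: (pb_is_pullback P).
  by constructor; exists F P K Q u.
- move=> X Y h; apply: get; case: h => h.
  + have [P] := J2_pb_exists ax (to_zero Y) h.
    by constructor; apply: swap; exact: mkprod.
  + have [P] := J2_pb_exists ax (to_zero X) h.
    by constructor; exact: mkprod.
- by move=> B; apply: get; exact: (J3_F ax).
Qed.

(* Values in the extended naturals, [None] standing for infinity. *)
Definition least (P : nat -> Prop) : option nat :=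
  match pselect (exists n, `[< P n >]) with
  | left exP => Some (ex_minn exP)
  | right _ => None
  end.

Lemma leastP (P : nat -> Prop) :
  match least P with
  | Some n => P n /\ (forall m, P m -> n <= m)
  | None => forall n, ~ P n
  end.
Proof.
rewrite /least; case: pselect => [exP|nP].
  by case: ex_minnP => n /asboolP Pn nmin; split=> // m /asboolP; exact: nmin.
by move=> n Pn; apply: nP; exists n; exact/asboolP.
Qed.

Section Ganea.
Variables (C : jcategory) (ch : choices C) (E B : C) (p : hom E B).

Fixpoint ganea (n : nat) : {X : C & hom X B} :=
  match n with
  | 0 => existT _ E p
  | n'.+1 =>
      let J := ch_join ch (projT2 (ganea n')) p in
      existT _ (join_obj J) (join_mor J)
  end.

Definition ganea_obj (n : nat) : C := projT1 (ganea n).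
Definition ganea_mor (n : nat) : hom (ganea_obj n) B := projT2 (ganea n).

Definition Gsecat : option nat := least (fun n => weak_section (ganea_mor n)).

End Ganea.

Section WhiteheadFibrant.
Variables (C : jcategory) (ch : choices C) (E B : C) (p : hom E B).
Hypothesis hB : e_fibrant B.

(* [power n] is the (n+1)-fold power of B, bracketed to the left. *)
Fixpoint power_sig (n : nat) : {P : C | e_fibrant P} :=
  match n with
  | 0 => exist _ B hB
  | n'.+1 =>
      let P := power_sig n' in
      let Q := ch_prod ch (or_introl (svalP P) : _ \/ e_fibrant B) in
      exist _ (pr_obj Q) (e_fibrant_product Q (svalP P) hB)
  end.

Definition power (n : nat) : C := sval (power_sig n).
Definition power_e_fibrant (n : nat) : e_fibrant (power n) :=
  svalP (power_sig n).

Definition power_prod (n : nat) : product (power n) B :=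
  ch_prod ch (or_introl (power_e_fibrant n)).

Fixpoint diagonal (n : nat) : hom B (power n) :=
  match n with
  | 0 => idm B
  | n'.+1 => pr_pair (power_prod n') (diagonal n') (idm B)
  end.

Definition times_id (n : nat) (T : C) (j : hom T (power n)) :
    hom (pr_obj (ch_prod ch (or_intror hB : e_fibrant T \/ _))) (power n.+1) :=
  prod_map _ (power_prod n) j (idm B).

Definition id_times (n : nat) :
    hom (pr_obj (ch_prod ch (or_introl (power_e_fibrant n) : _ \/ e_fibrant E)))
        (power n.+1) :=
  prod_map _ (power_prod n) (idm (power n)) p.

Fixpoint whitehead (n : nat) : {T : C & hom T (power n)} :=
  match n with
  | 0 => existT (fun T => hom T (power 0)) E p
  | n'.+1 =>
      let J := ch_join ch (times_id (projT2 (whitehead n'))) (id_times n') in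
      existT (fun T => hom T (power n'.+1)) (join_obj J) (join_mor J)
  end.

Definition whitehead_obj (n : nat) : C := projT1 (whitehead n).
Definition whitehead_mor (n : nat) : hom (whitehead_obj n) (power n) :=
  projT2 (whitehead n).

Definition Wsecat_e_fibrant : option nat :=
  least (fun n => weak_lifting (diagonal n) (whitehead_mor n)).

End WhiteheadFibrant.

(* For e-fibrant B, [ch_fib ch B] may be the factorization through the
   identity of B, in which case this is [Wsecat_e_fibrant] of p itself. *)
Definition Wsecat (C : jcategory) (ch : choices C) (E B : C) (p : hom E B) :
    option nat :=
  Wsecat_e_fibrant ch (F_we (ch_fib ch B) ∘ p)
    (e_fibrant_replacement (ch_fib ch B)).

(* Main.v *)
(** Joins commute with homotopy pullbacks: if f and g are the homotopy pullbacks
    of f' and g' along b, then the join morphism of f and g is the homotopy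
    pullback along b of that of f' and g'.  Factoring b, one may suppose that b
    is a fibration, where this is the cube axiom, or a weak equivalence, where it
    is the homotopy invariance of the join.  Let t : B -> B' be the chosen
    e-fibrant replacement.  Both factors of the join defining j_(n+1) are strict
    pullbacks along a projection, of j_n and of t p respectively; by induction
    h_n is the homotopy pullback of j_n along the composite of t with the diagonal
    of B'.  Hence h_n has a weak section iff this composite lifts weakly along
    j_n, and since all objects are cofibrant models t may be dropped from it. *)

From mathcomp Require Import all_boot boolp.
Require Import Defs.

Set Implicit Arguments.
Unset Strict Implicit.
Unset Printing Implicit Defensive.

(** * Pullback squares: pasting and cancellation *)

Section Pullbacks.
Variable C : category.

Lemma pb_comm (A E B P : C) (f : hom A B) (g : hom E B) (q : hom P A)
    (r : hom P E) : is_pullback f g q r -> f ∘ q = g ∘ r.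
Proof. by case. Qed.

Lemma pb_ex (A E B P : C) (f : hom A B) (g : hom E B) (q : hom P A)
    (r : hom P E) : is_pullback f g q r ->
  forall (X : C) (x : hom X A) (y : hom X E), f ∘ x = g ∘ y ->
  exists u : hom X P, q ∘ u = x /\ r ∘ u = y.
Proof. by case=> _ h X x y /h [u [hu _]]; exists u. Qed.

Lemma pb_uniq (A E B P : C) (f : hom A B) (g : hom E B) (q : hom P A)
    (r : hom P E) : is_pullback f g q r ->
  forall (X : C) (u v : hom X P), q ∘ u = q ∘ v -> r ∘ u = r ∘ v -> u = v.
Proof.
case=> e h X u v h1 h2; case: (h X (q ∘ v) (r ∘ v)) => [|w [_ hw]].
  by rewrite !compA e.
by rewrite -(hw u) // -(hw v).
Qed.

Lemma is_pullbackI (A E B P : C) (f : hom A B) (g : hom E B) (q : hom P A)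
    (r : hom P E) :
  f ∘ q = g ∘ r ->
  (forall (X : C) (x : hom X A) (y : hom X E), f ∘ x = g ∘ y ->
     exists u : hom X P, q ∘ u = x /\ r ∘ u = y) ->
  (forall (X : C) (u v : hom X P), q ∘ u = q ∘ v -> r ∘ u = r ∘ v -> u = v) ->
  is_pullback f g q r.
Proof.
move=> e ex uniq; split=> // X x y /ex [u [hx hy]]; exists u; split=> //.
by move=> v [vx vy]; apply: uniq; rewrite ?hx ?hy.
Qed.

Lemma is_pullback_sym (A E B P : C) (f : hom A B) (g : hom E B) (q : hom P A)
    (r : hom P E) : is_pullback f g q r -> is_pullback g f r q.
Proof.
move=> h; apply: is_pullbackI; first by rewrite (pb_comm h).
  by move=> X x y e; case: (pb_ex h (esym e)) => u [? ?]; exists u.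
by move=> X u v h1 h2; apply: (pb_uniq h).
Qed.

Lemma is_pullback_paste (A' A E B P P' : C) (a : hom A' A) (f : hom A B)
    (g : hom E B) (q : hom P A) (r : hom P E) (q' : hom P' A') (s : hom P' P) :
  is_pullback f g q r -> is_pullback a q q' s ->
  is_pullback (f ∘ a) g q' (r ∘ s).
Proof.
move=> h h'; apply: is_pullbackI.
- by rewrite -compA (pb_comm h') compA (pb_comm h) compA.
- move=> X x y; rewrite -compA => e.
  have [v [v1 v2]] := pb_ex h e.
  have [u [u1 u2]] := pb_ex h' (esym v1).
  by exists u; split=> //; rewrite -compA u2.
- move=> X u v e1 e2; apply: (pb_uniq h') => //; apply: (pb_uniq h).
    by rewrite !compA -(pb_comm h') -!compA e1.
  by rewrite !compA.
Qed.

Lemma is_pullback_cancel (A' A E B P P' : C) (a : hom A' A) (f : hom A B)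
    (g : hom E B) (q : hom P A) (r : hom P E) (q' : hom P' A') (r' : hom P' E)
    (s : hom P' P) :
  is_pullback f g q r -> is_pullback (f ∘ a) g q' r' ->
  q ∘ s = a ∘ q' -> r ∘ s = r' -> is_pullback a q q' s.
Proof.
move=> h h' e1 e2; apply: is_pullbackI => //.
- move=> X x y e.
  have e' : (f ∘ a) ∘ x = g ∘ (r ∘ y).
    by rewrite -compA e !compA (pb_comm h).
  have [u [u1 u2]] := pb_ex h' e'.
  exists u; split=> //; apply: (pb_uniq h).
    by rewrite compA e1 -compA u1.
  by rewrite compA e2.
- move=> X u v h1 h2; apply: (pb_uniq h') => //.
  by rewrite -e2 -!compA h2.
Qed.

Lemma isom_id (A : C) : isom (idm A).
Proof. by exists (idm A); rewrite comp1m. Qed.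

End Pullbacks.

(* The part of the axioms that only concerns fibrations; it holds for the
   cofibrations in the opposite category. *)
Record fib_axioms (C : category) (fib we : forall X Y : C, hom X Y -> Prop) :
    Prop := FibAxioms {
  fib_comp : forall (X Y Z : C) (g : hom Y Z) (f : hom X Y),
    fib _ _ g -> fib _ _ f -> fib _ _ (g ∘ f);
  we_comp : forall (X Y Z : C) (g : hom Y Z) (f : hom X Y),
    we _ _ f -> we _ _ g -> we _ _ (g ∘ f);
  we_left : forall (X Y Z : C) (g : hom Y Z) (f : hom X Y),
    we _ _ f -> we _ _ (g ∘ f) -> we _ _ g;
  we_right : forall (X Y Z : C) (g : hom Y Z) (f : hom X Y),
    we _ _ g -> we _ _ (g ∘ f) -> we _ _ f;
  fib_pb_exists : forall (E B B' : C) (f : hom B' B) (p : hom E B),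
    fib _ _ p -> inhabited (pullback f p);
  fib_pb : forall (E B B' E' : C) (f : hom B' B) (p : hom E B)
      (p' : hom E' B') (f' : hom E' E),
    fib _ _ p -> is_pullback f p p' f' -> fib _ _ p';
  we_pb_base : forall (E B B' E' : C) (f : hom B' B) (p : hom E B)
      (p' : hom E' B') (f' : hom E' E),
    fib _ _ p -> is_pullback f p p' f' -> we _ _ f -> we _ _ f';
  we_pb_fib : forall (E B B' E' : C) (f : hom B' B) (p : hom E B)
      (p' : hom E' B') (f' : hom E' E),
    fib _ _ p -> is_pullback f p p' f' -> we _ _ p -> we _ _ p';
  fib_factor : forall (X Y : C) (f : hom X Y),
    exists (Z : C) (p : hom Z Y) (t : hom X Z),
      [/\ fib _ _ p, we _ _ t & f = p ∘ t] }.

(** * Comparing factorizations and the pullbacks formed from them *)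

Section Comparison.
Variables (C : category) (fib we : forall X Y : C, hom X Y -> Prop).
Hypothesis ax : fib_axioms fib we.

(** Two F-factorizations of one map are dominated by a third: factor the induced map into the
    pullback of [p] and [h]. This replaces the lifting axiom that a J-category does not have. *)
Lemma dominate (G B E H : C) (p : hom E B) (h : hom H B)
    (t : hom G E) (v : hom G H) :
  fib p -> fib h -> we t -> we v -> p ∘ t = h ∘ v ->
  exists (W : C) (w : hom G W) (e : hom W E) (k : hom W H),
    [/\ we w, fib e /\ we e, fib k /\ we k, p ∘ e = h ∘ k &
        e ∘ w = t /\ k ∘ w = v].
Proof.
move=> fp fh wt wv eq.
have [[Q q1 q2 pbQ]] := fib_pb_exists ax p fh.
have [u [u1 u2]] := pb_ex pbQ eq.
have [W [z [w [fz ww defu]]]] := fib_factor ax u.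
have e1 : (q1 ∘ z) ∘ w = t by rewrite -compA -defu.
have e2 : (q2 ∘ z) ∘ w = v by rewrite -compA -defu.
exists W, w, (q1 ∘ z), (q2 ∘ z); split=> //.
- split; first exact: (fib_comp ax (fib_pb ax fh pbQ)).
  by apply: (we_left ax ww); rewrite e1.
- split; first exact: (fib_comp ax (fib_pb ax fp (is_pullback_sym pbQ))).
  by apply: (we_left ax ww); rewrite e2.
- by rewrite !compA (pb_comm pbQ).
Qed.

(** The factorizations of [g] and [g1] are chosen independently, so no map from [P] to [P1] need be
    available. A third factorization of [g] gives a zigzag of weak equivalences through [P2]
    instead. *)
Lemma pullback_comparison (A B G A1 B1 G1 E P E1 P1 : C)
    (f : hom A B) (g : hom G B) (f1 : hom A1 B1) (g1 : hom G1 B1)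
    (a : hom A A1) (b : hom B B1) (c : hom G G1)
    (p : hom E B) (t : hom G E) (q : hom P A) (r : hom P E)
    (p1 : hom E1 B1) (t1 : hom G1 E1) (q1 : hom P1 A1) (r1 : hom P1 E1) :
  we a -> we b -> we c -> b ∘ f = f1 ∘ a -> b ∘ g = g1 ∘ c ->
  [/\ fib p, we t & g = p ∘ t] -> is_pullback f p q r ->
  [/\ fib p1, we t1 & g1 = p1 ∘ t1] -> is_pullback f1 p1 q1 r1 ->
  exists (E2 P2 : C) (p2 : hom E2 B) (t2 : hom G E2) (q2 : hom P2 A)
         (r2 : hom P2 E2) (e : hom E2 E) (e1 : hom E2 E1) (d : hom P2 P)
         (d1 : hom P2 P1),
    [/\ [/\ fib p2, we t2 & g = p2 ∘ t2], is_pullback f p2 q2 r2,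
        [/\ we e, we e1, we d & we d1],
        [/\ p ∘ e = p2, e ∘ t2 = t, q ∘ d = q2 & r ∘ d = e ∘ r2] &
        [/\ p1 ∘ e1 = b ∘ p2, e1 ∘ t2 = t1 ∘ c, q1 ∘ d1 = a ∘ q2 &
            r1 ∘ d1 = e1 ∘ r2]].
Proof.
move=> wa wb wc sqf sqg [fp wt eg] pbP [fp1 wt1 eg1] pbP1.
(* Pulled back along [b], the factorization of [g1] becomes a second F-factorization [h1 ∘ v] of
   [g], to be dominated together with [p ∘ t]. *)
have [[H h1 h2 pbH]] := fib_pb_exists ax b fp1.
have eqH : b ∘ g = p1 ∘ (t1 ∘ c) by rewrite sqg eg1 compA.
have [v [v1 v2]] := pb_ex pbH eqH.
have fh1 := fib_pb ax fp1 pbH.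
have wh2 := we_pb_base ax fp1 pbH wb.
have wv : we v by apply: (we_right ax wh2); rewrite v2; exact: (we_comp ax).
have eqt : p ∘ t = h1 ∘ v by rewrite v1 eg.
have [E2 [t2 [e [k [wt2 [fe we_e] [fk wk] eqp [et kt]]]]]] :=
  dominate fp fh1 wt wv eqt.
have fp2 : fib (p ∘ e) := fib_comp ax fp fe.
have [[P2 q2 r2 pbP2]] := fib_pb_exists ax f fp2.
have eqd : f ∘ q2 = p ∘ (e ∘ r2) by rewrite (pb_comm pbP2) compA.
have [d [d_q d_r]] := pb_ex pbP eqd.
have wd : we d.
  have pbd : is_pullback e r r2 d.
    exact: (is_pullback_cancel (is_pullback_sym pbP) (is_pullback_sym pbP2)).
  exact: (we_pb_fib ax fe (is_pullback_sym pbd)).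
(* The map from [P2] to [P1] passes through [P3]: the first half is a base change of the trivial
   fibration [k], the second a base change of [a] along the fibration [q1]. *)
have [[P3 q3 r3 pbP3]] := fib_pb_exists ax f fh1.
have pbP3' : is_pullback (f1 ∘ a) p1 q3 (h2 ∘ r3).
  by rewrite -sqf; exact: (is_pullback_paste pbH pbP3).
have eqd3 : f1 ∘ (a ∘ q3) = p1 ∘ (h2 ∘ r3).
  by rewrite compA (pb_comm pbP3').
have [d3 [d3_q d3_r]] := pb_ex pbP1 eqd3.
have wd3 : we d3.
  have pbd : is_pullback a q1 q3 d3 by exact: (is_pullback_cancel pbP1 pbP3').
  exact: (we_pb_base ax (fib_pb ax fp1 pbP1) pbd).
have eqd2 : f ∘ q2 = h1 ∘ (k ∘ r2) by rewrite (pb_comm pbP2) eqp compA.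
have [d2 [d2_q d2_r]] := pb_ex pbP3 eqd2.
have wd2 : we d2.
  have pbP2' : is_pullback f (h1 ∘ k) q2 r2 by rewrite -eqp.
  have pbd : is_pullback k r3 r2 d2.
    exact: (is_pullback_cancel (is_pullback_sym pbP3) (is_pullback_sym pbP2')).
  exact: (we_pb_fib ax fk (is_pullback_sym pbd)).
exists E2, P2, (p ∘ e), t2, q2, r2, e, (h2 ∘ k), d, (d3 ∘ d2); split=> //.
- by split=> //; rewrite -compA et.
- by split=> //; exact: (we_comp ax).
- split.
  + by rewrite compA -(pb_comm pbH) -compA eqp.
  + by rewrite -compA kt.
  + by rewrite compA d3_q -compA d2_q.
  + by rewrite compA d3_r -!compA d2_r.
Qed.

End Comparison.

(** * Duality: pushouts of cofibrations from pullbacks of fibrations *)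

Definition op (C : category) : category :=
  @Category C (fun X Y => hom Y X) (@idm C) (fun X Y Z g f => f ∘ g)
    (fun W X Y Z h g f => esym (compA f g h))
    (fun X Y f => compm1 f) (fun X Y f => comp1m f).

Section JCategory.
Variable C : jcategory.
Let ax := jaxiomsP C.

Lemma fibration_axioms : fib_axioms (@fibration C) (@weak_equiv C).
Proof.
case: ax => *; split=> // X Y f.
by have [[Z t p *]] := J3_F ax f; exists Z, p, t.
Qed.

Lemma cofibration_axioms :
  @fib_axioms (op C) (fun X Y f => @cofibration C Y X f)
                     (fun X Y f => @weak_equiv C Y X f).
Proof.
split.
- by move=> X Y Z g f hg hf; exact: (J1_cof_comp ax).
- by move=> X Y Z g f hg hf; exact: (J1_we_comp ax).
- by move=> X Y Z g f; exact: (J1_we_right ax).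
- by move=> X Y Z g f; exact: (J1_we_left ax).
- move=> E B B' f p hp; have [[Q i j h]] := J2_po_exists ax f hp.
  by constructor; exact: (@Pullback (op C) _ _ _ f p Q i j h).
- by move=> E B B' E' f p p' f'; exact: (J2_po_cof ax).
- by move=> E B B' E' f p p' f'; exact: (J2_po_we_base ax).
- by move=> E B B' E' f p p' f'; exact: (J2_po_we_cof ax).
- move=> X Y f; have [[Z i s hi hs e]] := J3_C ax f.
  by exists Z, i, s.
Qed.

(** This is [pullback_comparison] in [op C]. Reversing the arrows exchanges the two rows, so the
    dominating factorization is one of [r1], and [D] and [D1] both map to [D2]. *)
Lemma pushout_comparison (P A X P1 A1 X1 Z Z1 D D1 : C)
    (q : hom P A) (r : hom P X) (q1 : hom P1 A1) (r1 : hom P1 X1)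
    (a : hom A A1) (d : hom P P1) (e : hom X X1)
    (i : hom P Z) (s : hom Z X) (k : hom A D) (l : hom Z D)
    (i1 : hom P1 Z1) (s1 : hom Z1 X1) (k1 : hom A1 D1) (l1 : hom Z1 D1) :
  weak_equiv a -> weak_equiv d -> weak_equiv e ->
  q1 ∘ d = a ∘ q -> r1 ∘ d = e ∘ r ->
  [/\ cofibration i, weak_equiv s & r = s ∘ i] -> is_pushout q i k l ->
  [/\ cofibration i1, weak_equiv s1 & r1 = s1 ∘ i1] -> is_pushout q1 i1 k1 l1 ->
  exists (Z2 D2 : C) (i2 : hom P1 Z2) (s2 : hom Z2 X1) (k2 : hom A1 D2)
         (l2 : hom Z2 D2) (z : hom Z Z2) (z1 : hom Z1 Z2) (m : hom D D2)
         (m1 : hom D1 D2),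
    [/\ [/\ cofibration i2, weak_equiv s2 & r1 = s2 ∘ i2],
        is_pushout q1 i2 k2 l2,
        weak_equiv m /\ weak_equiv m1,
        [/\ s2 ∘ z = e ∘ s, m ∘ k = k2 ∘ a & m ∘ l = l2 ∘ z] &
        [/\ s2 ∘ z1 = s1, m1 ∘ k1 = k2 & m1 ∘ l1 = l2 ∘ z1]].
Proof.
move=> wa wd we_e sq1 sq2 fact po fact1 po1.
have [Z2 [D2 [i2 [s2 [k2 [l2 [z1 [z [m1 [m]]]]]]]]]] :=
  @pullback_comparison (op C) _ _ cofibration_axioms A1 P1 X1 A P X Z1 D1 Z D
    q1 r1 q r a d e i1 s1 k1 l1 i s k l wa wd we_e sq1 sq2 fact1 po1 fact po.
case=> f2 po2 [_ _ wm1 wm] [_ z1s m1k m1l] [_ zs mk ml].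
by exists Z2, D2, i2, s2, k2, l2, z, z1, m, m1.
Qed.

(* The homotopy pullback of h' along b is weakly equivalent to h over B.  No map
   from X to X' is asked for: between two joins, or between the Ganea and
   Whitehead objects, there is in general no strictly compatible one. *)
Definition homotopy_pb (X B X' B' : C) (b : hom B B') (h : hom X B)
    (h' : hom X' B') : Prop :=
  exists (F : F_factorization h') (P : pullback b (F_fib F))
         (u : hom X (pb_obj P)),
    pb_fst P ∘ u = h /\ weak_equiv u.

Definition mk_F (X Z Y : C) (f : hom X Y) (p : hom Z Y) (t : hom X Z)
    (hp : fibration p) (ht : weak_equiv t) (e : f = p ∘ t) :
    F_factorization f := FFactorization ht hp e.

Lemma weak_equiv_id (X : C) : weak_equiv (idm X).
Proof. by case: (J1_iso_fib ax (isom_id X)). Qed.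

(** * First examples of homotopy pullbacks *)

Lemma homotopy_pb_square (X B X' B' : C) (b : hom B B') (h : hom X B)
    (h' : hom X' B') (c : hom X X') :
  weak_equiv b -> weak_equiv c -> b ∘ h = h' ∘ c -> homotopy_pb b h h'.
Proof.
move=> wb wc sq.
have [F] := J3_F ax h'.
have [P] := J2_pb_exists ax b (F_fibP F).
have e : b ∘ h = F_fib F ∘ (F_we F ∘ c) by rewrite sq compA -F_eq.
have [u [u1 u2]] := pb_ex (pb_is_pullback P) e.
exists F, P, u; split=> //.
apply: (J1_we_right ax (J2_pb_we_base ax (F_fibP F) (pb_is_pullback P) wb)).
by rewrite u2; apply: (J1_we_comp ax) => //; exact: F_weP.
Qed.

(** The induced map [u] is the base change of [F_we F] along a projection that is a fibration
    because [b] is one. *)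
Lemma homotopy_pb_strict (X B X' B' : C) (b : hom B B') (h : hom X B)
    (h' : hom X' B') (c : hom X X') :
  fibration b -> is_pullback b h' h c -> homotopy_pb b h h'.
Proof.
move=> fb pbX.
have [F] := J3_F ax h'.
have [P] := J2_pb_exists ax b (F_fibP F).
have pbP := pb_is_pullback P.
have e : b ∘ h = F_fib F ∘ (F_we F ∘ c).
  by rewrite compA -F_eq (pb_comm pbX).
have [u [u1 u2]] := pb_ex pbP e.
exists F, P, u; split=> //.
have pbu : is_pullback (F_we F) (pb_snd P) c u.
  apply: (is_pullback_cancel (is_pullback_sym pbP)) => //.
  by rewrite -F_eq u1; exact: is_pullback_sym pbX.
have fP := J2_pb_fib ax fb (is_pullback_sym pbP).
exact: (J2_pb_we_base ax fP pbu (F_weP F)).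
Qed.

(** Trades a homotopy pullback along a weak equivalence for strictly commuting squares, to which
    [join_square] applies. *)
Lemma homotopy_pb_cospan (X B X' B' : C) (b : hom B B') (h : hom X B)
    (h' : hom X' B') :
  weak_equiv b -> homotopy_pb b h h' ->
  exists (E : C) (q : hom E B') (a : hom X E) (a' : hom X' E),
    [/\ weak_equiv a, weak_equiv a', q ∘ a = b ∘ h & q ∘ a' = h'].
Proof.
move=> wb [F [P [u [u1 wu]]]].
exists (F_obj F), (F_fib F), (pb_snd P ∘ u), (F_we F); split.
- apply: (J1_we_comp ax) => //.
  exact: (J2_pb_we_base ax (F_fibP F) (pb_is_pullback P) wb).
- exact: F_weP.
- by rewrite compA -(pb_comm (pb_is_pullback P)) -compA u1.
- by rewrite -F_eq.
Qed.

(** * Independence of choices, composition and cancellation of homotopy pullbacks *)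

Section CofibrantModels.
Hypothesis hC : forall X : C, cofibrant_model X.

(** The pullback of [p] along [f] is a trivial fibration over the cofibrant model [X], hence has a
    section. *)
Lemma trivial_fibration_lift (X Y Z : C) (p : hom Y Z) (f : hom X Z) :
  trivial_fibration p -> exists g : hom X Y, p ∘ g = f.
Proof.
case=> fp wp; have [[Q q1 q2 pbQ]] := J2_pb_exists ax f fp.
have [s hs] : exists s : hom X Q, q1 ∘ s = idm X.
  apply: hC; split; first exact: (J2_pb_fib ax fp pbQ).
  exact: (J2_pb_we_fib ax fp pbQ).
by exists (q2 ∘ s); rewrite compA -(pb_comm pbQ) -compA hs compm1.
Qed.

Lemma F_factorization_dominate (G B : C) (g : hom G B)
    (F1 F2 : F_factorization g) :
  exists (W : C) (k1 : hom W (F_obj F1)) (k2 : hom W (F_obj F2)),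
    [/\ trivial_fibration k1, trivial_fibration k2 &
        F_fib F1 ∘ k1 = F_fib F2 ∘ k2].
Proof.
have e : F_fib F1 ∘ F_we F1 = F_fib F2 ∘ F_we F2 by rewrite -!F_eq.
have [W [w [k1 [k2 [_ h1 h2 h _]]]]] := dominate fibration_axioms
  (F_fibP F1) (F_fibP F2) (F_weP F1) (F_weP F2) e.
by exists W, k1, k2.
Qed.

Lemma weak_lifting_any (A G B : C) (f : hom A B) (g : hom G B)
    (F : F_factorization g) :
  weak_lifting f g -> exists s : hom A (F_obj F), F_fib F ∘ s = f.
Proof.
case=> F' [s hs].
have [W [k [k' [_ tk' e]]]] := F_factorization_dominate F F'.
have [v hv] := trivial_fibration_lift s tk'.
by exists (k ∘ v); rewrite compA e -compA hv.
Qed.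

(** The pullback [V] of a dominating factorization maps to both pullbacks by weak equivalences. The
    map [d'] is moreover a fibration, so [u] lifts through it and can be carried over to [Q] by
    [d]. *)
Lemma homotopy_pb_any (X B X' B' Q : C) (b : hom B B') (h : hom X B)
    (h' : hom X' B') (F : F_factorization h') (q : hom Q B)
    (r : hom Q (F_obj F)) :
  is_pullback b (F_fib F) q r -> homotopy_pb b h h' ->
  exists u : hom X Q, q ∘ u = h /\ weak_equiv u.
Proof.
move=> pbQ [F' [[P p1 p2 pbP] [u [/= u1 wu]]]].
have [W [k [k' [[fk wk] [fk' wk'] e]]]] := F_factorization_dominate F F'.
have fW := J1_fib_comp ax (F_fibP F) fk.
have [[V v1 v2 pbV]] := J2_pb_exists ax b fW.
have eqd : b ∘ v1 = F_fib F ∘ (k ∘ v2) by rewrite (pb_comm pbV) compA.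
have eqd' : b ∘ v1 = F_fib F' ∘ (k' ∘ v2) by rewrite (pb_comm pbV) e compA.
have [d [d1 d2]] := pb_ex pbQ eqd.
have [d' [d1' d2']] := pb_ex pbP eqd'.
have pbd : is_pullback r k d v2.
  apply: is_pullback_sym.
  exact: (is_pullback_cancel (is_pullback_sym pbQ) (is_pullback_sym pbV)).
have pbV' : is_pullback b (F_fib F' ∘ k') v1 v2 by rewrite -e.
have pbd' : is_pullback p2 k' d' v2.
  apply: is_pullback_sym.
  exact: (is_pullback_cancel (is_pullback_sym pbP) (is_pullback_sym pbV')).
have wd' := J2_pb_we_fib ax fk' pbd' wk'.
have [y hy] : exists y, d' ∘ y = u.
  by apply: trivial_fibration_lift; split; first exact: (J2_pb_fib ax fk' pbd').
exists (d ∘ y); split; first by rewrite compA d1 -d1' -compA hy.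
apply: (J1_we_comp ax); last exact: (J2_pb_we_fib ax fk pbd wk).
by apply: (J1_we_right ax wd'); rewrite hy.
Qed.

Lemma homotopy_pb_comp (X B X' B' X'' B'' : C) (b : hom B B') (b' : hom B' B'')
    (h : hom X B) (h' : hom X' B') (h'' : hom X'' B'') :
  homotopy_pb b h h' -> homotopy_pb b' h' h'' -> homotopy_pb (b' ∘ b) h h''.
Proof.
move=> H [F [[P p1 p2 pbP] [u [/= u1 wu]]]].
have fP := J2_pb_fib ax (F_fibP F) pbP.
have [[Q q1 q2 pbQ]] := J2_pb_exists ax b fP.
have [y [y1 wy]] :=
  (* The pair [p1], [u] is itself an F-factorization of [h']; with this choice the two pullbacks
     paste strictly. *)
  homotopy_pb_any (F := mk_F fP wu (esym u1)) pbQ H.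
by exists F, (Pullback (is_pullback_paste pbP pbQ)), y.
Qed.

Lemma homotopy_pb_cancel (X B X' B' X'' B'' : C) (b : hom B B')
    (b' : hom B' B'') (h : hom X B) (h' : hom X' B') (h'' : hom X'' B'') :
  homotopy_pb (b' ∘ b) h h'' -> homotopy_pb b' h' h'' -> homotopy_pb b h h'.
Proof.
move=> H [F [[P p1 p2 pbP] [u [/= u1 wu]]]].
have fP := J2_pb_fib ax (F_fibP F) pbP.
have [[Q q1 q2 pbQ]] := J2_pb_exists ax b fP.
have [y [y1 wy]] := homotopy_pb_any (F := F) (is_pullback_paste pbP pbQ) H.
by exists (mk_F fP wu (esym u1)), (Pullback pbQ), y.
Qed.

Lemma homotopy_pb_id_sym (X X' B : C) (h : hom X B) (h' : hom X' B) :
  homotopy_pb (idm B) h h' -> homotopy_pb (idm B) h' h.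
Proof.
case/(homotopy_pb_cospan (weak_equiv_id B)) => E [q [a [a' [wa wa' qa qa']]]].
have fa : homotopy_pb (idm B) h' q.
  by apply: (homotopy_pb_square (weak_equiv_id B) wa'); rewrite comp1m.
apply: (@homotopy_pb_cancel _ _ _ _ _ _ (idm B) (idm B) _ _ q).
  by rewrite comp1m.
by apply: (homotopy_pb_square (weak_equiv_id B) wa); rewrite qa.
Qed.

(** * Homotopy invariance of the join *)

Lemma pushout_uniq (P A X D Y : C) (q : hom P A) (r : hom P X) (k : hom A D)
    (l : hom X D) (u v : hom D Y) :
  is_pushout q r k l -> u ∘ k = v ∘ k -> u ∘ l = v ∘ l -> u = v.
Proof. by move=> po; exact: (@pb_uniq (op C) _ _ _ _ q r k l po). Qed.

Lemma join_comparison (P A X B P1 A1 X1 B1 Z Z1 D D1 : C)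
    (q : hom P A) (r : hom P X) (f : hom A B) (p : hom X B)
    (q1 : hom P1 A1) (r1 : hom P1 X1) (f1 : hom A1 B1) (p1 : hom X1 B1)
    (i : hom P Z) (s : hom Z X) (k : hom A D) (l : hom Z D) (m : hom D B)
    (i1 : hom P1 Z1) (s1 : hom Z1 X1) (k1 : hom A1 D1) (l1 : hom Z1 D1)
    (m1 : hom D1 B1)
    (a : hom A A1) (b : hom B B1) (d : hom P P1) (e : hom X X1) :
  weak_equiv a -> weak_equiv b -> weak_equiv d -> weak_equiv e ->
  [/\ q1 ∘ d = a ∘ q, r1 ∘ d = e ∘ r, b ∘ f = f1 ∘ a & b ∘ p = p1 ∘ e] ->
  [/\ cofibration i, weak_equiv s & r = s ∘ i] -> is_pushout q i k l ->
  m ∘ k = f /\ m ∘ l = p ∘ s ->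
  [/\ cofibration i1, weak_equiv s1 & r1 = s1 ∘ i1] -> is_pushout q1 i1 k1 l1 ->
  f1 ∘ q1 = p1 ∘ r1 ->
  m1 ∘ k1 = f1 /\ m1 ∘ l1 = p1 ∘ s1 ->
  homotopy_pb b m m1.
Proof.
move=> wa wb wd we_e [sq1 sq2 sqf sqp] fact po [mk ml] fact1 po1 sqB [mk1 ml1].
have [Z2 [D2 [i2 [s2 [k2 [l2 [z [z1 [n [n1]]]]]]]]]] :=
  pushout_comparison wa wd we_e sq1 sq2 fact po fact1 po1.
case=> -[_ _ er2] po2 [wn wn1] [s2z nk nl] [s2z1 n1k n1l].
have [|m2 [[m2k m2l] _]] := proj2 po2 B1 f1 (p1 ∘ s2).
  by rewrite sqB er2 compA.
have m2n : b ∘ m = m2 ∘ n.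
  apply: (pushout_uniq po); rewrite -!compA.
    by rewrite mk nk compA m2k.
  by rewrite ml nl !compA m2l sqp -!compA s2z.
have m2n1 : m1 = m2 ∘ n1.
  apply: (pushout_uniq po1); rewrite -!compA.
    by rewrite mk1 n1k m2k.
  by rewrite ml1 n1l compA m2l -compA s2z1.
(* Both [n] and [n1] point into [D2], so [m] and [m1] are each compared with [m2]; cancellation then
   compares them with each other. *)
apply: (@homotopy_pb_cancel _ _ _ _ _ _ b (idm B1) m m1 m2).
  by rewrite comp1m; exact: (homotopy_pb_square wb wn).
by apply: (homotopy_pb_square (weak_equiv_id B1) wn1); rewrite comp1m.
Qed.

Lemma join_square (A G B A1 G1 B1 : C) (f : hom A B) (g : hom G B)
    (f1 : hom A1 B1) (g1 : hom G1 B1) (J : join f g) (J1 : join f1 g1)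
    (a : hom A A1) (b : hom B B1) (c : hom G G1) :
  weak_equiv a -> weak_equiv b -> weak_equiv c ->
  b ∘ f = f1 ∘ a -> b ∘ g = g1 ∘ c ->
  homotopy_pb b (join_mor J) (join_mor J1).
Proof.
case: J => [[E t p wt fp eg]] [/= P q r pbP] [/= Z i s ci ws er] /=.
case=> [D k l poD] /= m mk ml.
case: J1 => [[E1 t1 p1 wt1 fp1 eg1]] [/= P1 q1 r1 pbP1].
case=> [/= Z1 i1 s1 ci1 ws1 er1] [/= D1 k1 l1 poD1] /= m1 mk1 ml1.
move=> wa wb wc sqf sqg.
have [E2 [P2 [p2 [t2 [q2 [r2 [e [e1 [d [d1]]]]]]]]]] :=
  pullback_comparison fibration_axioms wa wb wc sqf sqg
    (And3 fp wt eg) pbP (And3 fp1 wt1 eg1) pbP1.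
case=> [[fp2 wt2 eg2] pbP2 [we_e we_e1 wd wd1] [pe _ qd rd] [pe1 _ qd1 rd1]].
(* An auxiliary join of [f] and [g], built on the dominating factorization, maps strictly to the
   data of [J] over [idm B] and to those of [J1] over [b]. *)
have [[Z2 i2 s2 ci2 ws2 er2]] := J3_C ax r2.
have [[D2 k2 l2 poD2]] := J2_po_exists ax q2 ci2.
have [m2 [[m2k m2l] _]] : exists! m2, m2 ∘ k2 = f /\ m2 ∘ l2 = p2 ∘ s2.
  apply: (proj2 poD2); rewrite (pb_comm pbP2) er2; exact: compA.
have mD2 : m2 ∘ k2 = f /\ m2 ∘ l2 = p2 ∘ s2 by [].
have H : homotopy_pb (idm B) m2 m.
  apply: (join_comparison (weak_equiv_id A) (weak_equiv_id B) wd we_e _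
    (And3 ci2 ws2 er2) poD2 mD2 (And3 ci ws er) poD (pb_comm pbP) (conj mk ml)).
  by rewrite !comp1m compm1 pe.
have H1 : homotopy_pb b m2 m1.
  apply: (join_comparison wa wb wd1 we_e1 _
    (And3 ci2 ws2 er2) poD2 mD2 (And3 ci1 ws1 er1) poD1 (pb_comm pbP1)
    (conj mk1 ml1)).
  by split.
by rewrite -(compm1 b); exact: (homotopy_pb_comp (homotopy_pb_id_sym H) H1).
Qed.

(** The cospans attached to both hypotheses end in maps [f2] and [g2] over [B1]; the joins [J] and
    [J1] are compared through a join of these. *)
Lemma join_weak_equiv (A G B A1 G1 B1 : C) (f : hom A B) (g : hom G B)
    (f1 : hom A1 B1) (g1 : hom G1 B1) (J : join f g) (J1 : join f1 g1)
    (b : hom B B1) :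
  weak_equiv b -> homotopy_pb b f f1 -> homotopy_pb b g g1 ->
  homotopy_pb b (join_mor J) (join_mor J1).
Proof.
move=> wb /(homotopy_pb_cospan wb) [A2 [f2 [a [a1 [wa wa1 fa fa1]]]]].
move=> /(homotopy_pb_cospan wb) [G2 [g2 [c [c1 [wc wc1 gc gc1]]]]].
have [ch] := choices_exist C; pose J2 := ch_join ch f2 g2.
apply: (@homotopy_pb_cancel _ _ _ _ _ _ b (idm B1) _ _ (join_mor J2)).
  by rewrite comp1m; exact: (join_square J J2 wa wb wc (esym fa) (esym gc)).
by apply: (join_square J1 J2 wa1 (weak_equiv_id B1) wc1); rewrite comp1m.
Qed.

(** * The cube axiom and base change of joins *)

Lemma homotopy_pullback_strict (D A X B : C) (x : hom D A) (c : hom D X)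
    (f : hom A B) (g : hom X B) :
  fibration g -> is_pullback f g x c -> homotopy_pullback x c f g.
Proof.
move=> fg pbD; split; first exact: pb_comm pbD.
exists (mk_F fg (weak_equiv_id X) (esym (compm1 g))), (Pullback pbD), (idm D).
by rewrite /= compm1 comp1m; split; rewrite ?compm1 //; exact: weak_equiv_id.
Qed.

(* Pulling the whole construction of the join back along b gives a cube of
   strict pullbacks whose bottom face is the defining pushout; the cube axiom
   then provides the top face. *)
Lemma join_pullback (B A' G' B' : C) (f' : hom A' B') (g' : hom G' B')
    (b : hom B B') (J' : join f' g') :
  fibration b ->
  exists (A1 G1 : C) (f1 : hom A1 B) (g1 : hom G1 B) (J1 : join f1 g1),
    [/\ homotopy_pb b f1 f', homotopy_pb b g1 g' &
        homotopy_pb b (join_mor J1) (join_mor J')].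
Proof.
case: J' => F [/= P q r pbP] [/= Z i s ci ws er] [/= D k l poD] /= m mk ml fb.
have pull (Y : C) (y : hom Y B') : exists (Y1 : C) (y1 : hom Y1 B) (c : hom Y1 Y),
    is_pullback b y y1 c /\ fibration c.
  have [[Q q1 q2 pbQ]] := J2_pb_exists ax y fb.
  exists Q, q2, q1; split; first exact: is_pullback_sym pbQ.
  exact: (J2_pb_fib ax fb pbQ).
have [A1 [f1 [ca [pbA fa]]]] := pull _ f'.
have [X1 [p1 [cx [pbX fx]]]] := pull _ (F_fib F).
have [D1 [m1 [cd [pbD fd]]]] := pull _ m.
have [P1 [n1 [cp [pbP1 fp]]]] := pull _ (f' ∘ q).
have [Z1 [o1 [cz [pbZ fz]]]] := pull _ (F_fib F ∘ s).
have lift (Y Y' Y1 Y1' : C) (y : hom Y B') (y' : hom Y' B') (y1 : hom Y1 B)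
    (y1' : hom Y1' B) (c : hom Y1 Y) (c' : hom Y1' Y') (v : hom Y Y') :
    is_pullback b y y1 c -> is_pullback b y' y1' c' -> y' ∘ v = y ->
    exists v1 : hom Y1 Y1', [/\ y1' ∘ v1 = y1, c' ∘ v1 = v ∘ c &
                                is_pullback v c' c v1].
  move=> h h' e.
  have eq : b ∘ y1 = y' ∘ (v ∘ c) by rewrite (pb_comm h) -e compA.
  have [v1 [e1 e2]] := pb_ex h' eq; exists v1; split=> //.
  apply: (is_pullback_cancel (is_pullback_sym h')) => //.
  by rewrite e e1; exact: is_pullback_sym h.
have [q1 [q1f cq pbq]] := lift _ _ _ _ _ _ _ _ _ _ q pbP1 pbA erefl.
have [r1 [r1p cr pbr]] :=
  lift _ _ _ _ _ _ _ _ _ _ r pbP1 pbX (esym (pb_comm pbP)).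
have [s1 [s1p cs pbs]] := lift _ _ _ _ _ _ _ _ _ _ s pbZ pbX erefl.
have eqi : (F_fib F ∘ s) ∘ i = f' ∘ q by rewrite -compA -er (pb_comm pbP).
have [i1 [i1o ci1 pbi]] := lift _ _ _ _ _ _ _ _ _ _ i pbP1 pbZ eqi.
have [k1 [k1m ck pbk]] := lift _ _ _ _ _ _ _ _ _ _ k pbA pbD mk.
have [l1 [l1m cl pbl]] := lift _ _ _ _ _ _ _ _ _ _ l pbZ pbD ml.
have top : homotopy_pushout q1 i1 k1 l1.
  (* The vertical edges are base changes of the fibration [b], which makes the strict vertical faces
     homotopy pullbacks. *)
  apply: (J5 ax (r := cp) (s := ca) (t := cz) (v := cd) (kl := q) (km := i)
    (ln := k) (mn := l)); try exact: homotopy_pullback_strict.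
  - apply: (pb_uniq pbD); rewrite !compA ?k1m ?l1m ?q1f ?i1o //.
    by rewrite ck cl -!compA cq ci1 !compA (proj1 poD).
  - split; first exact: (proj1 poD).
    exists (CFactorization ci (weak_equiv_id Z) (esym (comp1m i))).
    exists (Pushout poD), (idm D).
    by split; rewrite /= ?comp1m ?compm1 //; exact: weak_equiv_id.
have wcx : weak_equiv s1.
  exact: (J2_pb_we_base ax fx pbs ws).
(* The map [i1] is not known to be a cofibration. The homotopy pushout supplies a C-factorization of
   it, and composing its weak equivalence with [s1] yields one of [r1], hence a genuine join. *)
case: top => _ [[/= Z2 i2 s2 ci2 ws2 ei2] [[/= D2 k2 l2 poD2] [u [/= uk ul wu]]]].
have fp1 : fibration p1 := J2_pb_fib ax (F_fibP F) pbX.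
have pbP1' : is_pullback f1 p1 q1 r1.
  apply: (is_pullback_cancel pbX _ _ erefl); last by rewrite r1p -q1f.
  rewrite (pb_comm pbA) cr.
  exact: (is_pullback_paste pbP (is_pullback_sym pbq)).
have er1 : r1 = s1 ∘ s2 ∘ i2.
  rewrite -compA -ei2; apply: (pb_uniq pbX).
    by rewrite compA s1p i1o.
  by rewrite compA cs -compA ci1 compA -er.
pose F1 := mk_F fp1 (weak_equiv_id X1) (esym (compm1 p1)).
pose K1 := CFactorization (f := pb_snd (Pullback (g := F_fib F1) pbP1')) ci2
  (J1_we_comp ax ws2 wcx) er1.
have inl : m1 ∘ u ∘ k2 = f1 by rewrite -compA uk.
have inr : m1 ∘ u ∘ l2 = p1 ∘ (s1 ∘ s2).
  by rewrite -compA ul !compA l1m s1p.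
exists A1, X1, f1, p1, (@Join _ _ _ _ _ _ F1 (Pullback (g := F_fib F1) pbP1') K1
  (Pushout poD2) (m1 ∘ u) inl inr); split=> /=.
- exact: (homotopy_pb_strict fb pbA).
- by exists F, (Pullback pbX), (idm X1); rewrite compm1; split=> //;
    exact: weak_equiv_id.
- rewrite -(compm1 b); apply: (homotopy_pb_comp (h' := m1)).
    by apply: (homotopy_pb_square (weak_equiv_id B) wu); rewrite comp1m.
  exact: (homotopy_pb_strict fb pbD).
Qed.

(** Write [b] as [v ∘ t]. Cancellation turns the hypotheses into homotopy pullbacks along [t] of
    maps [f1], [g1] pulled back along [v]; the two halves then compose. *)
Lemma join_theorem (A G B A' G' B' : C) (f : hom A B) (g : hom G B)
    (f' : hom A' B') (g' : hom G' B') (b : hom B B') (J : join f g)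
    (J' : join f' g') :
  homotopy_pb b f f' -> homotopy_pb b g g' ->
  homotopy_pb b (join_mor J) (join_mor J').
Proof.
have [[Bh t v wt fv ->]] := J3_F ax b => Hf Hg.
have [A1 [G1 [f1 [g1 [J1 [Hf1 Hg1 HJ1]]]]]] := join_pullback J' fv.
apply: (homotopy_pb_comp _ HJ1); apply: (join_weak_equiv _ _ wt).
  exact: homotopy_pb_cancel Hf Hf1.
exact: homotopy_pb_cancel Hg Hg1.
Qed.

(** * Weak sections, weak liftings and homotopy pullbacks *)

(** Since [p1 ∘ u] is an F-factorization of [h], a weak section of [h] amounts to a section of [p1],
    which by the universal property of [P] is a lift of [b] through [F_fib F]. *)
Lemma weak_section_homotopy_pb (X B X' B' : C) (b : hom B B') (h : hom X B)
    (h' : hom X' B') :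
  homotopy_pb b h h' -> weak_section h <-> weak_lifting b h'.
Proof.
move=> [F [[P p1 p2 pbP] [u [/= u1 wu]]]].
have fP := J2_pb_fib ax (F_fibP F) pbP.
split.
  case/(weak_lifting_any (mk_F fP wu (esym u1))) => /= s hs.
  by exists F, (p2 ∘ s); rewrite compA -(pb_comm pbP) -compA hs compm1.
case/(weak_lifting_any F) => s hs.
have [|v [v1 _]] := pb_ex pbP (x := idm B) (y := s); first by rewrite compm1.
by exists (mk_F fP wu (esym u1)), v.
Qed.

Lemma weak_lifting_weak_equiv (A B D G : C) (t : hom A B) (f : hom B D)
    (g : hom G D) :
  weak_equiv t -> weak_lifting (f ∘ t) g <-> weak_lifting f g.
Proof.
move=> wt; split; last by case=> F [s hs]; exists F, (s ∘ t); rewrite compA hs.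
case=> F [s hs]; exists F.
have [[Q q1 q2 pbQ]] := J2_pb_exists ax f (F_fibP F).
have [v [v1 _]] := pb_ex pbQ (esym hs).
(* The projection [q1] need not be a weak equivalence, but after factoring [v] the composite
   [q1 ∘ p] is one, as [t] and [w] are; its section gives the lift. *)
have [[W w p ww fp ev]] := J3_F ax v.
have tf : trivial_fibration (q1 ∘ p).
  split; first by apply: (J1_fib_comp ax) => //; exact: (J2_pb_fib ax (F_fibP F) pbQ).
  by apply: (J1_we_left ax ww); rewrite -compA -ev v1.
have [y hy] := hC tf.
by exists (q2 ∘ p ∘ y); rewrite !compA -(pb_comm pbQ) -!compA (compA q1) hy compm1.
Qed.

(** * Products and the induction from Ganea to Whitehead *)

Lemma prod_map_id_pullback (X Y Y' : C) (h : hom X Y) (Q : product X Y')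
    (Q' : product Y Y') :
  is_pullback (pr_fst Q') h (prod_map Q Q' h (idm Y')) (pr_fst Q).
Proof.
apply: is_pullbackI; first by rewrite pr_fst_pair.
  move=> Z x y e; exists (pr_pair Q y (pr_snd Q' ∘ x)); rewrite pr_fst_pair.
  split=> //; apply: (pr_pair_uniq (p := Q')); rewrite compA.
    by rewrite pr_fst_pair -compA pr_fst_pair.
  by rewrite pr_snd_pair comp1m pr_snd_pair.
move=> Z u v e1 e2; apply: (pr_pair_uniq (p := Q)) => //.
have := congr1 (comp (pr_snd Q')) e1.
by rewrite !compA pr_snd_pair !comp1m.
Qed.

Lemma prod_id_map_pullback (X X' Y : C) (h : hom X Y) (Q : product X' X)
    (Q' : product X' Y) :
  is_pullback (pr_snd Q') h (prod_map Q Q' (idm X') h) (pr_snd Q).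
Proof.
apply: is_pullbackI; first by rewrite pr_snd_pair.
  move=> Z x y e; exists (pr_pair Q (pr_fst Q' ∘ x) y); rewrite pr_snd_pair.
  split=> //; apply: (pr_pair_uniq (p := Q')); rewrite compA.
    by rewrite pr_fst_pair comp1m pr_fst_pair.
  by rewrite pr_snd_pair -compA pr_snd_pair.
move=> Z u v e1 e2; apply: (pr_pair_uniq (p := Q)) => //.
have := congr1 (comp (pr_fst Q')) e1.
by rewrite !compA pr_fst_pair !comp1m.
Qed.

Lemma product_pullback (X Y : C) (Q : product X Y) :
  is_pullback (to_zero X) (to_zero Y) (pr_fst Q) (pr_snd Q).
Proof.
apply: is_pullbackI; first by rewrite [LHS]to_zero_uniq [RHS]to_zero_uniq.
  by move=> Z x y _; exists (pr_pair Q x y); rewrite pr_fst_pair pr_snd_pair.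
by move=> Z u v; exact: pr_pair_uniq.
Qed.

Lemma fibration_pr_fst (X Y : C) (Q : product X Y) :
  e_fibrant Y -> fibration (pr_fst Q).
Proof. by move=> fY; exact: (J2_pb_fib ax fY (product_pullback Q)). Qed.

Lemma fibration_pr_snd (X Y : C) (Q : product X Y) :
  e_fibrant X -> fibration (pr_snd Q).
Proof.
by move=> fX; exact: (J2_pb_fib ax fX (is_pullback_sym (product_pullback Q))).
Qed.

Lemma ganea_whitehead_pb (chG chW : choices C) (E B B' : C) (p : hom E B)
    (t : hom B B') (hB' : e_fibrant B') (n : nat) :
  weak_equiv t ->
  homotopy_pb (diagonal chW hB' n ∘ t) (ganea_mor chG p n)
              (whitehead_mor chW (t ∘ p) hB' n).
Proof.
move=> wt.
have Hp : homotopy_pb t p (t ∘ p).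
  by apply: (homotopy_pb_square wt (weak_equiv_id E)); rewrite compm1.
elim: n => [|n IHn]; first by rewrite /= comp1m.
apply: join_theorem.
  (* The first projection of the diagonal is the previous diagonal, so cancelling it leaves the
     induction hypothesis. *)
  apply: (@homotopy_pb_cancel _ _ _ _ _ _ _ (pr_fst (power_prod chW hB' n)) _ _
            (whitehead_mor chW (t ∘ p) hB' n)).
    by rewrite compA pr_fst_pair.
  apply: homotopy_pb_strict; first exact: fibration_pr_fst.
  exact: prod_map_id_pullback.
(* The last projection of the diagonal is the identity, which leaves [Hp]. *)
apply: (@homotopy_pb_cancel _ _ _ _ _ _ _ (pr_snd (power_prod chW hB' n)) _ _
          (t ∘ p)).
  by rewrite compA pr_snd_pair comp1m.
apply: homotopy_pb_strict.
  by apply: fibration_pr_snd; exact: power_e_fibrant.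
exact: prod_id_map_pullback.
Qed.

End CofibrantModels.
End JCategory.

Lemma eq_least (P Q : nat -> Prop) : (forall n, P n <-> Q n) -> least P = least Q.
Proof. by move=> PQ; congr least; apply/funext => n; exact/propext. Qed.

Theorem theorem15 (C : jcategory) (hC : forall X : C, cofibrant_model X)
  (chG chW : choices C) (E B : C) (p : hom E B) :
  Gsecat chG p = Wsecat chW p.
Proof.
apply: eq_least => n; have wt := F_weP (ch_fib chW B).
apply: (iff_trans (weak_section_homotopy_pb hC
  (ganea_whitehead_pb hC chG chW p (e_fibrant_replacement _) n wt))).
exact: weak_lifting_weak_equiv.
Qed.
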